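(* Let $f:\mathbb{R}\to\mathbb{R}$ be $f(x)=x^3-3x$. Let $K$ be a finite, constructible extension of $\mathbb{Q}$ (i.e. a field $K\subset\mathbb{R}$ of finite degree over $\mathbb{Q}$ all of whose elements are constructible numbers), and let $F\subset\mathbb{R}$ be a real, finite extension of $K$ such that $[F:K]$ is prime to $2$ and $3$. Then: (a) $Tri\cap F=f(F\cap[-2,2])$; (b) no element of $f(F\setminus K)$ is constructible. In particular, when $F\ne K$, $f(F\setminus K)$ contains a countable infinity of trisection numbers that are not constructible.
   Context: Let $S\subseteq\mathbb{R}^2$ contain $(0,0)$ and $(1,0)$. A point is constructible over $S$ if it can be obtained from points of $S$ by a finite sequence of straightedge-and-compass steps: (1) given two distinct points already available, one may draw the line through them, or the circle centered at one of them and passing through the other; (2) given two lines, two circles, or a line and a circle already drawn, one may add their intersection points. $C(S)$ denotes the set of all points constructible over $S$. A real number $x$ is constructible if $(x,0)\in C(\{(0,0),(1,0)\})$; equivalently, $x$ lies in the top field of a finite tower of real quadratic extensions starting at $\mathbb{Q}$. The constructible numbers form a subfield of $\mathbb{R}$, and its subfields are called constructible fields. An angle $\alpha$ (in radians) is trisectable if $(\cos(\alpha/3),\sin(\alpha/3))\in C(\{(0,0),(1,0),(\cos\alpha,\sin\alpha)\})$. A trisection number is a real number of the form $2\cos\alpha$ with $\alpha$ trisectable; $Tri\subseteq[-2,2]$ is the set of all trisection numbers. *)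

(* Defs.v *)
From HB Require Import structures.
From mathcomp Require Import all_boot all_order all_algebra all_field.
From mathcomp Require Import all_classical all_reals all_analysis.

Set Implicit Arguments.
Unset Strict Implicit.
Unset Printing Implicit Defensive.

Import Order.TTheory GRing.Theory Num.Theory.

Local Open Scope classical_set_scope.
Local Open Scope ring_scope.

Section Constructibility.
Variable R : realType.
Implicit Types (S X Y : set (R * R)) (p q r : R * R) (x a : R).

Definition line p q : set (R * R) :=
  [set r | (r.1 - p.1) * (q.2 - p.2) = (r.2 - p.2) * (q.1 - p.1)].

(* The circle centered at p and passing through q. *)
Definition circle p q : set (R * R) :=
  [set r | (r.1 - p.1) ^+ 2 + (r.2 - p.2) ^+ 2 =
           (q.1 - p.1) ^+ 2 + (q.2 - p.2) ^+ 2].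

Definition drawn p q X : Prop := p <> q /\ (X = line p q \/ X = circle p q).

(* Only distinct curves are intersected: X <> Y is an inequality of point sets,
   as the same curve can be drawn from several pairs of points. *)
Inductive constructible_from S : R * R -> Prop :=
| constructible_base p : S p -> constructible_from S p
| constructible_meet p1 q1 p2 q2 X Y r :
    constructible_from S p1 -> constructible_from S q1 ->
    constructible_from S p2 -> constructible_from S q2 ->
    drawn p1 q1 X -> drawn p2 q2 Y -> X <> Y ->
    X r -> Y r -> constructible_from S r.

Definition constructible : set R :=
  [set x | constructible_from [set (0, 0); (1, 0)] (x, 0)].

Definition trisectable a : Prop :=
  constructible_from [set (0, 0); (1, 0); (cos a, sin a)]
    (cos (a / 3), sin (a / 3)).

Definition Tri : set R := [set 2 * cos a | a in trisectable].

Definition trisection_poly x : R := x ^+ 3 - 3 * x.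

End Constructibility.

Arguments constructible {R}.
Arguments Tri {R}.
Arguments trisection_poly {R}.

(* The tower of real fields K <= F is presented by abstract finite extensions
   F / K / rat together with an embedding of F into R; these are the images of
   F and of K under that embedding. *)
Definition real_field (R : realType) (K : fieldType) (F : fieldExtType K)
  (iota : {rmorphism F -> R}) : set R := range iota.

Definition real_base_field (R : realType) (K : fieldType) (F : fieldExtType K)
  (iota : {rmorphism F -> R}) : set R := range (fun k : K => iota k%:A).

(* Main.v *)
(* The coordinates of a constructible point lie in a tower of real quadratic
   extensions of any field containing the given coordinates, and conversely the
   constructible coordinates form a field closed under square roots.

   If y = 2 cos a lies in F and a is trisectable, then X^3 - 3 X - y has a root
   in a quadratic tower over F, hence a root in F, since an irreducible cubic
   stays irreducible over a quadratic extension. Conversely, for x in F the degree of x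
   over K(f(x)) is at most 3 and divides [F : K], so it is 1: x lies in K(f(x))
   and is constructible as soon as f(x) is available. If moreover f(x) is
   constructible, then x is constructible and lies in F, which has odd degree
   over K, so x lies in K. *)
Require Import Defs.
From HB Require Import structures.
From mathcomp Require Import all_boot all_order all_algebra all_field.
From mathcomp Require Import all_classical all_reals all_analysis.
From mathcomp Require Import ring lra.

Set Implicit Arguments.
Unset Strict Implicit.
Unset Printing Implicit Defensive.

Import Order.TTheory GRing.Theory Num.Theory.

Local Open Scope classical_set_scope.
Local Open Scope ring_scope.

(** * Subfields of the reals and quadratic towers *)

Section Subfields.
Variable R : realType.
Implicit Types (E G V : set R) (x y s : R).

Record subfield E : Prop := Subfield {
  subfield1 : E 1;
  subfieldB : forall x y, E x -> E y -> E (x - y);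
  subfieldM : forall x y, E x -> E y -> E (x * y);
  subfieldV : forall x, E x -> E x^-1 }.

Section Closure.
Variables (E : set R) (sE : subfield E).

Lemma subfield0 : E 0.
Proof. by rewrite -(subrr 1); apply: (subfieldB sE); apply: (subfield1 sE). Qed.

Lemma subfieldN x : E x -> E (- x).
Proof. by move=> Ex; rewrite -sub0r; apply: (subfieldB sE) => //; apply: subfield0. Qed.

Lemma subfieldD x y : E x -> E y -> E (x + y).
Proof. by move=> Ex Ey; rewrite -(opprK y); apply: (subfieldB sE) => //; apply: subfieldN. Qed.

Lemma subfieldX x n : E x -> E (x ^+ n).
Proof.
move=> Ex; elim: n => [|n IHn]; first by rewrite expr0; apply: (subfield1 sE).
by rewrite exprS; apply: (subfieldM sE).
Qed.

Lemma subfield_nat n : E n%:R.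
Proof.
elim: n => [|n IHn]; first exact: subfield0.
by rewrite -natr1; apply: subfieldD => //; apply: (subfield1 sE).
Qed.

Lemma subfield_sum (I : finType) (F : I -> R) :
  (forall i, E (F i)) -> E (\sum_i F i).
Proof. by move=> EF; apply: (big_ind E) => //; [apply: subfield0|apply: subfieldD]. Qed.

Lemma subfield_det n (M : 'M[R]_n) : (forall i j, E (M i j)) -> E (\det M).
Proof.
move=> EM; apply: subfield_sum => p; apply: (subfieldM sE).
  by apply: subfieldX; apply: subfieldN; apply: (subfield1 sE).
by apply: (big_ind E) => //; [apply: (subfield1 sE)|apply: (subfieldM sE)].
Qed.

Lemma subfield_horner (p : {poly R}) x : (forall i, E p`_i) -> E x -> E p.[x].
Proof.
move=> Ep Ex; rewrite horner_coef; apply: subfield_sum => i.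
by apply: (subfieldM sE) => //; apply: subfieldX.
Qed.

End Closure.

End Subfields.

Ltac mem sE := repeat first
  [ assumption | apply: (subfieldB sE) | apply: (subfieldN sE)
  | apply: (subfieldD sE) | apply: (subfieldV sE) | apply: (subfieldX sE)
  | apply: (subfield_nat sE) | apply: (subfield0 sE) | apply: (subfield1 sE)
  | apply: (subfieldM sE) ].

Section Towers.
Variable R : realType.
Implicit Types (E G V : set R) (x y s : R).

(** This is a field only when [s ^+ 2] lies in [E]. Nothing excludes [s] from [E], so a step has
    degree 1 or 2. *)
Definition adj E s : set R := [set z | exists a b, [/\ E a, E b & z = a + b * s]].

Lemma sub_adj E s : subfield E -> E `<=` adj E s.
Proof. by move=> sE x Ex; exists x, 0; split; mem sE; ring. Qed.

Lemma adj_gen E s : subfield E -> adj E s s.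
Proof. by move=> sE; exists 0, 1; split; mem sE; ring. Qed.

Lemma subfield_adj E s : subfield E -> E (s ^+ 2) -> subfield (adj E s).
Proof.
move=> sE Ed; split.
- by apply: sub_adj => //; apply: (subfield1 sE).
- move=> _ _ [a [b [Ea Eb ->]]] [c [e [Ec Ee ->]]].
  by exists (a - c), (b - e); split; mem sE; ring.
- move=> _ _ [a [b [Ea Eb ->]]] [c [e [Ec Ee ->]]].
  by exists (a * c + b * e * s ^+ 2), (a * e + b * c); split; mem sE; ring.
- move=> _ [a [b [Ea Eb ->]]].
  (* The inverse comes from multiplying by the conjugate [a - b * s]. The conjugate can vanish for a
     nonzero element when [s] already lies in [E]; the element is then [a + a]. *)
  have [abs0|abs_neq0] := eqVneq (a - b * s) 0.
    have -> : b * s = a by lra.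
    by apply: sub_adj => //; mem sE.
  have [->|abs1] := eqVneq (a + b * s) 0.
    by rewrite invr0; apply: sub_adj => //; mem sE.
  exists (a / (a ^+ 2 - b ^+ 2 * s ^+ 2)), (- b / (a ^+ 2 - b ^+ 2 * s ^+ 2)).
  have -> : a ^+ 2 - b ^+ 2 * s ^+ 2 = (a - b * s) * (a + b * s) by ring.
  split; last by field; rewrite abs_neq0 abs1.
    have -> : (a - b * s) * (a + b * s) = a ^+ 2 - b ^+ 2 * s ^+ 2 by ring.
    by mem sE.
  have -> : (a - b * s) * (a + b * s) = a ^+ 2 - b ^+ 2 * s ^+ 2 by ring.
  by mem sE.
Qed.

(** The adjunction takes place at the bottom, so induction on a tower carries a property from
    [adj E s] down to [E]. *)
Inductive tower : set R -> set R -> Prop :=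
| tower_refl E : tower E E
| tower_step E s E' : E (s ^+ 2) -> tower (adj E s) E' -> tower E E'.

Lemma tower_trans E1 E2 E3 : tower E1 E2 -> tower E2 E3 -> tower E1 E3.
Proof.
move=> t12; elim: t12 E3 => // E s E' Es _ IH E3 t23.
exact: (tower_step Es (IH _ t23)).
Qed.

Lemma tower_sub E E' : tower E E' -> subfield E -> subfield E' /\ E `<=` E'.
Proof.
elim=> [{E E'}E sE|{E E'}E s E' Es _ IH sE]; first by split => // x.
have [sE' EE'] := IH (subfield_adj sE Es).
by split => // x Ex; apply: EE'; apply: sub_adj.
Qed.

(* If a + b s with b <> 0 is a root then so is its conjugate a - b s; as the
   roots of the cubic add up to 0, the third one is - 2 a. *)
Lemma tower_trisection_root E E' y : tower E E' -> subfield E -> E y ->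
  (exists2 x, E' x & trisection_poly x = y) ->
  exists2 x, E x & trisection_poly x = y.
Proof.
elim=> [{E E'}E sE //|{E E'}E s E' Es _ IH sE Ey xP].
have [_ [a [b [Ea Eb ->]]] fx] := IH (subfield_adj sE Es) (sub_adj _ sE Ey) xP.
have [Es1|nEs] := pselect (E s).
  by exists (a + b * s) => //; mem sE.
have [b0|b_neq0] := eqVneq b 0.
  by exists a => //; rewrite -fx b0 mul0r addr0.
(* [u] and [v] are the components on [1] and [s] of [trisection_poly (a + b * s) - y]. Both vanish
   because [s] is not in [E]. *)
pose u := a ^+ 3 + 3 * a * b ^+ 2 * s ^+ 2 - 3 * a - y.
pose v := b * (3 * a ^+ 2 + b ^+ 2 * s ^+ 2 - 3).
have uv : u + v * s = 0 by rewrite /u /v -fx /trisection_poly; ring.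
have v0 : v = 0.
  apply/eqP; apply: contra_notT nEs => v_neq0.
  have -> : s = - u / v.
    by rewrite (_ : - u = s * v) ?mulfK //; move: uv; clear; lra.
  by rewrite /u /v; mem sE.
have u0 : u = 0 by move: uv; rewrite v0 mul0r addr0.
have w0 : 3 * a ^+ 2 + b ^+ 2 * s ^+ 2 - 3 = 0.
  by apply: (mulfI b_neq0); rewrite mulr0.
exists (- 2%:R * a); first by mem sE.
(* The left side equals [trisection_poly (- 2 * a) - y]. *)
have : u - 3 * a * (3 * a ^+ 2 + b ^+ 2 * s ^+ 2 - 3) = 0 by rewrite u0 w0; ring.
rewrite /u /trisection_poly => h.
have -> : y = y + 0 by rewrite addr0.
by rewrite -h; ring.
Qed.

(** The base is a set of reals rather than a type, so that [E] and [V] can be enlarged inside [R]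
    while the family [v] is kept. *)
Definition is_basis E V n (v : 'I_n -> R) :=
  (forall x, V x <-> exists2 a : 'I_n -> R, (forall i, E (a i)) &
      x = \sum_i a i * v i) /\
  (forall a : 'I_n -> R, (forall i, E (a i)) -> \sum_i a i * v i = 0 ->
      forall i, a i = 0).

Lemma basis_sub E V n (v : 'I_n -> R) : subfield E -> is_basis E V v ->
  forall i, V (v i).
Proof.
move=> sE [spn _] i; apply/spn; exists (fun j => (j == i)%:R).
  by move=> j; apply: subfield_nat.
rewrite (bigD1 i) //= eqxx mul1r big1 ?addr0 // => j /negbTE ->.
by rewrite mul0r.
Qed.

(* If M is the matrix of multiplication by s, then M ^ 2 = s ^ 2 and
   (det M) ^ 2 = (s ^ 2) ^ n, so s ^ 2 is a square in E when n is odd. *)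
Lemma odd_sqrt E V n (v : 'I_n -> R) s : odd n -> subfield E -> subfield V ->
  is_basis E V v -> V s -> E (s ^+ 2) -> E s.
Proof.
move=> odd_n sE sV bv Vs Es.
have [->|s_neq0] := eqVneq s 0; first exact: subfield0.
have Vv := basis_sub sE bv; case: bv => spn indep.
have /choice [m mP] i : exists a : 'I_n -> R,
    (forall j, E (a j)) /\ s * v i = \sum_j a j * v j.
  have /spn[a Ea sv] : V (s * v i) by apply: (subfieldM sV).
  by exists a.
pose M : 'M[R]_n := \matrix_(i, j) m i j.
pose w : 'cV[R]_n := \col_i v i.
have wE k : w k ord0 = v k by rewrite mxE.
have Mw : M *m w = s *: w.
  apply/matrixP => i j; rewrite !mxE; case: (mP i) => _ ->.
  by apply: eq_bigr => k _; rewrite !mxE.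
have MM : M *m M = (s ^+ 2)%:M.
  apply/eqP; rewrite -subr_eq0; apply/eqP/matrixP => i j; rewrite [RHS]mxE.
  (* The matrix [M *m M - (s ^+ 2)%:M] kills the vector [w] of basis elements, so each of its rows
     is a linear relation over [E] and vanishes. *)
  apply: (indep (fun j => (M *m M - (s ^+ 2)%:M) i j)).
    move=> k; rewrite !mxE; apply: (subfieldB sE).
      by apply: subfield_sum => // l; rewrite !mxE; apply: (subfieldM sE); apply: (mP _).1.
    by case: eqP => _; rewrite ?mulr1n ?mulr0n //; apply: subfield0.
  transitivity (((M *m M - (s ^+ 2)%:M) *m w) i ord0).
    by rewrite [RHS]mxE; apply: eq_bigr => k _; rewrite wE.
  rewrite mulmxBl -mulmxA Mw -scalemxAr Mw scalerA mul_scalar_mx expr2 subrr.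
  by rewrite mxE.
have Edet : E (\det M) by apply: subfield_det => // i j; rewrite mxE; apply: (mP i).1.
have detM : (\det M) ^+ 2 = (s ^+ n) ^+ 2.
  by rewrite expr2 -det_mulmx MM det_scalar -!exprM mulnC.
have Esn : E (s ^+ n).
  move/eqP: detM; rewrite eqf_sqr => /orP[/eqP <- //|/eqP d].
  by rewrite -(opprK (s ^+ n)) -d; apply: subfieldN.
have -> : s = s ^+ n / (s ^+ 2) ^+ n./2.
  rewrite -{1}(odd_double_half n) odd_n add1n exprS -exprM -mul2n mulfK //.
  by rewrite expf_neq0.
by apply: (subfieldM sE) => //; apply: (subfieldV sE); apply: subfieldX.
Qed.

(** As [s] is not in [V], a relation over [adj E s] splits into two relations over [E], one for each
    of [1] and [s]. The degree [n] thus survives the adjunction. *)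
Lemma basis_adj E V n (v : 'I_n -> R) s : subfield E -> subfield V ->
  is_basis E V v -> ~ V s -> is_basis (adj E s) (adj V s) v.
Proof.
move=> sE sV [spn indep] nVs; split=> [x|a Ea av0].
  split=> [[_ [_ [/spn[a Ea ->] /spn[b Eb ->] ->]]]|[a Ea ->]].
    exists (fun i => a i + b i * s).
      by move=> i; exists (a i), (b i).
    rewrite mulr_suml -big_split /=; apply: eq_bigr => i _; ring.
  have /choice [b bP] i : exists b, E b.1 /\ E b.2 /\ a i = b.1 + b.2 * s.
    by have [c [d [Ec Ed ->]]] := Ea i; exists (c, d).
  exists (\sum_i (b i).1 * v i), (\sum_i (b i).2 * v i); split.
  - by apply/spn; exists (fun i => (b i).1) => // i; case: (bP i).
  - by apply/spn; exists (fun i => (b i).2) => // i; case: (bP i) => _ [].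
  rewrite mulr_suml -big_split /=; apply: eq_bigr => i _.
  by have [_ [_ ->]] := bP i; ring.
have /choice [b bP] i : exists b, E b.1 /\ E b.2 /\ a i = b.1 + b.2 * s.
  by have [c [d [Ec Ed ->]]] := Ea i; exists (c, d).
have Eb1 i : E (b i).1 by case: (bP i).
have Eb2 i : E (b i).2 by case: (bP i) => _ [].
pose A := \sum_i (b i).1 * v i; pose B := \sum_i (b i).2 * v i.
have VA : V A by apply/spn; exists (fun i => (b i).1).
have VB : V B by apply/spn; exists (fun i => (b i).2).
have AB : A + B * s = 0.
  rewrite -av0 mulr_suml -big_split /=; apply: eq_bigr => i _.
  by have [_ [_ ->]] := bP i; ring.
have B0 : B = 0.
  apply/eqP; apply: contra_notT nVs => B_neq0.
  have -> : s = - A / B.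
    by rewrite (_ : - A = s * B) ?mulfK //; move: AB; clear; lra.
  by mem sV.
have A0 : A = 0 by move: AB; rewrite B0 mul0r addr0.
by move=> i; have [_ [_ ->]] := bP i; rewrite (indep _ Eb1 A0) (indep _ Eb2 B0) mul0r
  addr0.
Qed.

(** Take the first adjoined root [s]. If it lies in [V], odd degree puts it in [E] and the step is
    trivial. Otherwise adjoin [s] to [V] as well, which keeps the degree, and descend from
    [adj E s]. *)
Lemma tower_odd E E' : tower E E' -> forall V n (v : 'I_n -> R), odd n ->
  subfield E -> subfield V -> E `<=` V -> is_basis E V v ->
  E' `&` V `<=` E.
Proof.
elim=> [{E E'}E V n v _ _ _ _ _ x []//|{E E'}E s E' Es _ IH V n v odd_n sE sV EV bv].
move=> x [E'x Vx].
have [Vs|nVs] := pselect (V s).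
  have Es1 := odd_sqrt odd_n sE sV bv Vs Es.
  have adjE : adj E s = E.
    rewrite eqEsubset; split; last exact: sub_adj.
    by move=> _ [a [b [Ea Eb ->]]]; mem sE.
  by rewrite adjE in IH; apply: (IH V n v).
have [a [b [Ea Eb xE]]] : adj E s x.
  apply: (IH (adj V s) n v odd_n); first exact: subfield_adj.
  - by apply: subfield_adj => //; apply: EV.
  - by move=> _ [a [b [Ea Eb ->]]]; exists a, b; split => //; apply: EV.
  - exact: basis_adj.
  - by split => //; apply: sub_adj.
(* An element of [V] has no component along [s], since otherwise [s] would lie in [V]. *)
have b0 : b = 0.
  apply/eqP; apply: contra_notT nVs => b_neq0.
  have -> : s = (x - a) / b by rewrite xE; field.
  have Va := EV _ Ea; have Vb := EV _ Eb; by mem sV.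
by rewrite xE b0 mul0r addr0.
Qed.

End Towers.

(** * Coordinates of constructible points *)

Section Coordinates.
Variable R : realType.
Implicit Types (E G : set R) (S X Y : set (R * R)) (p q r : R * R).

Definition linear_curve a b c : set (R * R) := [set r | a * r.1 + b * r.2 = c].

(** The leading coefficients are fixed to 1, so that the difference of two such equations is
    linear. *)
Definition quadratic_curve a b c : set (R * R) :=
  [set r | r.1 ^+ 2 + r.2 ^+ 2 + a * r.1 + b * r.2 = c].

Lemma drawn_curve E p q X : subfield E -> drawn p q X ->
  E p.1 -> E p.2 -> E q.1 -> E q.2 ->
  exists a b c, [/\ E a, E b, E c &
    (a ^+ 2 + b ^+ 2 != 0 /\ X = linear_curve a b c) \/ X = quadratic_curve a b c].
Proof.
case: p q => p1 p2 [q1 q2] sE [pq XE] /= Ep1 Ep2 Eq1 Eq2.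
case: XE => ->.
  exists (q2 - p2), (p1 - q1), (p1 * (q2 - p2) + p2 * (p1 - q1)); split; mem sE.
  left; split.
    rewrite paddr_eq0 ?sqr_ge0 // !sqrf_eq0 !subr_eq0.
    by apply/negP => /andP[/eqP e2 /eqP e1]; apply: pq; rewrite e1 e2.
  by rewrite eqEsubset; split=> -[x y]; rewrite /line /linear_curve /= => h; lra.
exists (- 2%:R * p1), (- 2%:R * p2), ((q1 - p1) ^+ 2 + (q2 - p2) ^+ 2 - p1 ^+ 2 - p2 ^+ 2).
split; mem sE; right.
by rewrite eqEsubset; split=> -[x y]; rewrite /circle /quadratic_curve /= => h; lra.
Qed.

Lemma meet_linear_quadratic E a b c a' b' c' r : subfield E ->
  E a -> E b -> E c -> E a' -> E b' -> E c' -> a ^+ 2 + b ^+ 2 != 0 ->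
  linear_curve a b c r -> quadratic_curve a' b' c' r ->
  exists s, [/\ E (s ^+ 2), adj E s r.1 & adj E s r.2].
Proof.
case: r => x y; rewrite /linear_curve /quadratic_curve /=.
move=> sE Ea Eb Ec Ea' Eb' Ec' n0 l q.
pose n := a ^+ 2 + b ^+ 2.
pose h := (b' * a - a' * b) / 2%:R.
have En : E n by rewrite /n; mem sE.
have Eh : E h by rewrite /h; mem sE.
(* On the line, [a * y - b * x] is a coordinate satisfying a quadratic equation over [E]; the shift
   by [h] completes the square. *)
exists (a * y - b * x + h); split.
- have -> : (a * y - b * x + h) ^+ 2 =
    n * c' - c * (a' * a + b' * b) - c ^+ 2 + h ^+ 2.
    by rewrite -q -l /n /h; field.
  by mem sE.
- exists ((a * c + b * h) / n), (- b / n); split; mem sE.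
  by rewrite -l /n; field.
- exists ((b * c - a * h) / n), (a / n); split; mem sE.
  by rewrite -l /n; field.
Qed.

Lemma meet_linear E a b c a' b' c' r : subfield E ->
  E a -> E b -> E c -> E a' -> E b' -> E c' ->
  a ^+ 2 + b ^+ 2 != 0 -> a' ^+ 2 + b' ^+ 2 != 0 ->
  linear_curve a b c <> linear_curve a' b' c' ->
  linear_curve a b c r -> linear_curve a' b' c' r -> E r.1 /\ E r.2.
Proof.
case: r => x y; move=> sE Ea Eb Ec Ea' Eb' Ec' n0 n0' XY.
rewrite ![linear_curve _ _ _ (x, y)]/linear_curve /= => l l'.
have [det0|det_neq0] := eqVneq (a * b' - a' * b) 0; last first.
  have -> : x = (c * b' - c' * b) / (a * b' - a' * b) by rewrite -l -l'; field.
  have -> : y = (a * c' - a' * c) / (a * b' - a' * b) by rewrite -l -l'; field.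
  by split; mem sE.
(* Parallel lines with a common point coincide, against the hypothesis. *)
case: XY; rewrite eqEsubset; split=> -[u v]; rewrite /linear_curve /= => h.
  apply/eqP; rewrite -subr_eq0 -(mulrI_eq0 _ (lregP n0)).
  suff -> : (a ^+ 2 + b ^+ 2) * (a' * u + b' * v - c') =
    (a * b' - a' * b) * (a * (v - y) - b * (u - x))
     + (a * a' + b * b') * ((a * u + b * v) - (a * x + b * y)).
    by rewrite det0 h l subrr mulr0 mul0r addr0.
  by rewrite -l'; ring.
apply/eqP; rewrite -subr_eq0 -(mulrI_eq0 _ (lregP n0')).
suff -> : (a' ^+ 2 + b' ^+ 2) * (a * u + b * v - c) =
  - (a * b' - a' * b) * (a' * (v - y) - b' * (u - x))
   + (a * a' + b * b') * ((a' * u + b' * v) - (a' * x + b' * y)).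
  by rewrite det0 h l' subrr mulr0 oppr0 mul0r addr0.
by rewrite -l; ring.
Qed.

(** Subtracting the two equations gives the radical axis, which reduces the problem to a line and a
    circle. *)
Lemma meet_quadratic E a b c a' b' c' r : subfield E ->
  E a -> E b -> E c -> E a' -> E b' -> E c' ->
  quadratic_curve a b c <> quadratic_curve a' b' c' ->
  quadratic_curve a b c r -> quadratic_curve a' b' c' r ->
  exists s, [/\ E (s ^+ 2), adj E s r.1 & adj E s r.2].
Proof.
move=> sE Ea Eb Ec Ea' Eb' Ec' XY q q'.
have l : linear_curve (a - a') (b - b') (c - c') r.
  by move: q q'; rewrite /quadratic_curve /linear_curve /= => <- <-; ring.
apply: (meet_linear_quadratic sE _ _ _ Ea Eb Ec _ l q); mem sE.
(* If the linear coefficients agreed, the common point would make the constants agree too, and the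
   curves would be equal. *)
rewrite paddr_eq0 ?sqr_ge0 // !sqrf_eq0 !subr_eq0.
apply/negP => /andP[/eqP ea /eqP eb]; apply: XY.
by move: q q'; rewrite /quadratic_curve /= ea eb => -> ->.
Qed.

Lemma meet_adj E p1 q1 p2 q2 X Y r : subfield E ->
  drawn p1 q1 X -> drawn p2 q2 Y -> X <> Y -> X r -> Y r ->
  E p1.1 -> E p1.2 -> E q1.1 -> E q1.2 -> E p2.1 -> E p2.2 -> E q2.1 -> E q2.2 ->
  exists s, [/\ E (s ^+ 2), adj E s r.1 & adj E s r.2].
Proof.
move=> sE dX dY XY Xr Yr Ep11 Ep12 Eq11 Eq12 Ep21 Ep22 Eq21 Eq22.
have [a [b [c [Ea Eb Ec Xe]]]] := drawn_curve sE dX Ep11 Ep12 Eq11 Eq12.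
have [a' [b' [c' [Ea' Eb' Ec' Ye]]]] := drawn_curve sE dY Ep21 Ep22 Eq21 Eq22.
case: Xe Ye => [[n0 Xe]|Xe] [[n0' Ye]|Ye]; subst X Y.
- have [Er1 Er2] := meet_linear sE Ea Eb Ec Ea' Eb' Ec' n0 n0' XY Xr Yr.
  by exists 0; split; [mem sE|exact: sub_adj|exact: sub_adj].
- exact: (meet_linear_quadratic sE Ea Eb Ec Ea' Eb' Ec').
- exact: (meet_linear_quadratic sE Ea' Eb' Ec' Ea Eb Ec).
- exact: (meet_quadratic sE Ea Eb Ec Ea' Eb' Ec').
Qed.

(** [E] is quantified after the derivation: the induction hypotheses for the four defining points
    are applied in turn, each over the field produced by the one before. *)
Lemma constructible_tower S r : constructible_from S r -> forall E, subfield E ->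
  (forall p, S p -> E p.1 /\ E p.2) ->
  exists E', [/\ tower E E', E' r.1 & E' r.2].
Proof.
elim=> {r} [p Sp E sE SE|p1 q1 p2 q2 X Y r _ IHp1 _ IHq1 _ IHp2 _ IHq2 dX dY XY Xr Yr E sE SE].
  by have [] := SE p Sp; exists E; split => //; exact: tower_refl.
have [E1 [t1 p11 p12]] := IHp1 E sE SE.
have [sE1 EE1] := tower_sub t1 sE.
have [E2 [t2 q11 q12]] := IHq1 E1 sE1 (fun p Sp =>
  conj (EE1 _ (SE p Sp).1) (EE1 _ (SE p Sp).2)).
have [sE2 E12] := tower_sub t2 sE1.
have [E3 [t3 p21 p22]] := IHp2 E2 sE2 (fun p Sp =>
  conj (E12 _ (EE1 _ (SE p Sp).1)) (E12 _ (EE1 _ (SE p Sp).2))).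
have [sE3 E23] := tower_sub t3 sE2.
have [E4 [t4 q21 q22]] := IHq2 E3 sE3 (fun p Sp =>
  conj (E23 _ (E12 _ (EE1 _ (SE p Sp).1))) (E23 _ (E12 _ (EE1 _ (SE p Sp).2)))).
have [sE4 E34] := tower_sub t4 sE3.
have [||||||||s [E4s r1 r2]] := meet_adj sE4 dX dY XY Xr Yr; auto.
exists (adj E4 s); split => //.
apply: (tower_trans t1); apply: (tower_trans t2); apply: (tower_trans t3).
by apply: (tower_trans t4); apply: (tower_step E4s); exact: tower_refl.
Qed.

End Coordinates.

(** * Geometric arithmetic *)

Section Constructions.
Variable R : realType.
Implicit Types (p q r : R * R).

Lemma constructible_from_sub (S S' : set (R * R)) :
  S `<=` S' -> constructible_from S `<=` constructible_from S'.
Proof.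
move=> SS' r; elim=> {r} [p /SS'|p1 q1 p2 q2 X Y r _ cp1 _ cq1 _ cp2 _ cq2].
  exact: constructible_base.
exact: constructible_meet.
Qed.

Variable S : set (R * R).
Hypotheses (S0 : S (0, 0)) (S1 : S (1, 0)).
Local Notation C := (constructible_from S).

Lemma pair_neq (x y u v : R) : (x != u) || (y != v) -> (x, y) <> (u, v).
Proof.
move=> h /eqP; rewrite xpair_eqE => /andP[/eqP xu /eqP yv].
by rewrite xu yv !eqxx in h.
Qed.

(* The point w witnesses that the two curves are distinct. *)
Lemma constructible_meet_sep p1 q1 p2 q2 X Y r w :
  C p1 -> C q1 -> C p2 -> C q2 -> drawn p1 q1 X -> drawn p2 q2 Y ->
  X w -> ~ Y w -> X r -> Y r -> C r.
Proof.
move=> cp1 cq1 cp2 cq2 dX dY Xw nYw.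
by apply: (constructible_meet cp1 cq1 cp2 cq2 dX dY) => XY; rewrite XY in Xw.
Qed.

Let C0 : C (0, 0). Proof. exact: constructible_base. Qed.
Let C1 : C (1, 0). Proof. exact: constructible_base. Qed.

(** The line through both points meets the circle about [(u, v)] again at the reflected point. *)
Lemma constructible_reflect x y u v :
  C (x, y) -> C (u, v) -> C (2 * u - x, 2 * v - y).
Proof.
move=> cp cq; have [/eqP|pq] := eqVneq (x, y) (u, v).
  rewrite xpair_eqE => /andP[/eqP xu /eqP yv].
  by rewrite -xu -yv (_ : 2 * x - x = x) 1?(_ : 2 * y - y = y) //; ring.
apply: (@constructible_meet_sep (x, y) (u, v) (u, v) (x, y)
  (line (x, y) (u, v)) (circle (u, v) (x, y)) _ (u, v)) => //.
- by split; [exact/eqP|left].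
- by split; [apply/eqP; rewrite eq_sym|right].
- by rewrite /line /=; ring.
- rewrite /circle /= !subrr expr0n addr0 => /esym/eqP.
  rewrite paddr_eq0 ?sqr_ge0 // !sqrf_eq0 !subr_eq0 => /andP[/eqP xu /eqP yv].
  by rewrite xu yv eqxx in pq.
- by rewrite /line /=; ring.
- by rewrite /circle /=; ring.
Qed.

Lemma constructible_opp x y : C (x, y) -> C (- x, - y).
Proof. by move=> cp; have := constructible_reflect cp C0; rewrite mulr0 !sub0r. Qed.

(** The line through the apices of the two equilateral triangles on the segment is its perpendicular
    bisector. *)
Lemma constructible_midpoint x y u v :
  C (x, y) -> C (u, v) -> C ((x + u) / 2, (y + v) / 2).
Proof.
move=> cp cq; have [/eqP|pq] := eqVneq (x, y) (u, v).
  rewrite xpair_eqE => /andP[/eqP xu /eqP yv].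
  by rewrite -xu -yv (_ : (x + x) / 2 = x) 1?(_ : (y + y) / 2 = y) //; field.
have d0 : (x - u) ^+ 2 + (y - v) ^+ 2 != 0.
  apply: contra pq; rewrite paddr_eq0 ?sqr_ge0 // !sqrf_eq0 !subr_eq0.
  by rewrite xpair_eqE.
pose t : R := Num.sqrt 3 / 2.
have t2 : t ^+ 2 = 3 / 4 by rewrite /t exprMn sqr_sqrtr //; field.
have t0 : t != 0.
  by apply: contraTneq isT => t0; move: t2; rewrite t0 expr0n /=; lra.
(* e 1 and e (-1) are the apices of the equilateral triangles on pq. *)
pose e (k : R) := ((x + u) / 2 - k * t * (v - y), (y + v) / 2 + k * t * (u - x)).
have ce k : k ^+ 2 = 1 -> C (e k).
  move=> k2.
  apply: (@constructible_meet_sep (x, y) (u, v) (u, v) (x, y)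
    (circle (x, y) (u, v)) (circle (u, v) (x, y)) _ (2 * x - u, 2 * y - v)) => //.
  - by split; [exact/eqP|right].
  - by split; [apply/eqP; rewrite eq_sym|right].
  - by rewrite /circle /=; ring.
  - rewrite /circle /= => h; move/eqP: d0; apply; lra.
  - transitivity (((u - x) ^+ 2 + (v - y) ^+ 2) * (1 / 4 + k ^+ 2 * t ^+ 2)).
      by rewrite /e /=; field.
    by rewrite k2 t2 /=; field.
  - transitivity (((u - x) ^+ 2 + (v - y) ^+ 2) * (1 / 4 + k ^+ 2 * t ^+ 2)).
      by rewrite /e /=; field.
    by rewrite k2 t2 /=; field.
have ce1 : C (e 1) by apply: ce; rewrite expr1n.
have ce2 : C (e (- 1)) by apply: ce; rewrite sqrrN expr1n.
apply: (@constructible_meet_sep (x, y) (u, v) (e 1) (e (-1))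
  (line (x, y) (u, v)) (line (e 1) (e (- 1))) _ (x, y)) => //.
- by split; [exact/eqP|left].
- split; last by left.
  rewrite /e => -[h1 h2]; move/eqP: d0; apply.
  have vy : v - y = 0 by apply: (mulfI t0); lra.
  have ux : u - x = 0 by apply: (mulfI t0); lra.
  by rewrite -(opprB u) ux -(opprB v) vy; ring.
- by rewrite /line /=; ring.
- rewrite /line /e /= => h; move/eqP: d0; apply.
  by apply: (mulfI t0); lra.
- by rewrite /line /=; field.
- by rewrite /line /e /=; field.
Qed.

(** Reflecting the origin in the midpoint completes the parallelogram. *)
Lemma constructible_add x y u v : C (x, y) -> C (u, v) -> C (x + u, y + v).
Proof.
move=> cp cq; have := constructible_reflect C0 (constructible_midpoint cp cq).
by rewrite !subr0 !(mulrC 2) !divfK.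
Qed.

(** The circles about [(0, 0)] and [(1, 0)] through the point meet again at its mirror image in the
    x-axis. *)
Lemma constructible_conj x y : C (x, y) -> C (x, - y).
Proof.
move=> cp; have [x0|x0] := eqVneq x 0.
  by have := constructible_opp cp; rewrite x0 oppr0.
(* For [y] nonzero the point differs from both centers, so both circles can be drawn. *)
have [y0|y0] := eqVneq y 0; first by rewrite y0 oppr0 -y0.
apply: (@constructible_meet_sep (0, 0) (x, y) (1, 0) (x, y)
  (circle (0, 0) (x, y)) (circle (1, 0) (x, y)) _ (- x, y)) => //.
- by split; [apply: pair_neq; rewrite (eq_sym 0) x0|right].
- by split; [apply: pair_neq; rewrite (eq_sym 0) y0 orbT|right].
- by rewrite /circle /=; ring.
- by rewrite /circle /= => h; move/eqP: x0; apply; lra.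
- by rewrite /circle /=; ring.
- by rewrite /circle /=; ring.
Qed.

Definition constructible_coord : set R := [set x | C (x, 0)].
Local Notation N := constructible_coord.

(** An equilateral triangle on the segment from -1 to 1 has its apex on the y-axis; the axis then
    cuts the unit circle. *)
Let C01 : C (0, 1).
Proof.
have CN1 : C (-1, 0) by have := constructible_opp C1; rewrite oppr0.
pose t : R := Num.sqrt 3.
have t2 : t ^+ 2 = 3 by rewrite sqr_sqrtr.
have t0 : t != 0.
  by apply: contraTneq isT => t0; move: t2; rewrite t0 expr0n /=; lra.
have Ct : C (0, t).
  apply: (@constructible_meet_sep (1, 0) (-1, 0) (-1, 0) (1, 0)
    (circle (1, 0) (-1, 0)) (circle (-1, 0) (1, 0)) _ (-1, 0)) => //.
  - by split; [apply: pair_neq; apply/orP; left; apply/eqP; lra|right].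
  - by split; [apply: pair_neq; apply/orP; left; apply/eqP; lra|right].
  - by rewrite /circle /= => h; lra.
  - by rewrite /circle /= subr0 t2; ring.
  - by rewrite /circle /= subr0 t2; ring.
apply: (@constructible_meet_sep (0, 0) (1, 0) (0, 0) (0, t)
  (circle (0, 0) (1, 0)) (line (0, 0) (0, t)) _ (1, 0)) => //.
- by split; [apply: pair_neq; rewrite eq_sym oner_eq0|right].
- by split; [apply: pair_neq; rewrite (eq_sym 0 t) t0 orbT|left].
- by rewrite /line /= => h; move/eqP: t0; apply; lra.
- by rewrite /circle /=; ring.
- by rewrite /line /=; ring.
Qed.

Lemma constructible_swap y : C (0, y) -> N y.
Proof.
rewrite /N /= => cy; have [y0|y0] := eqVneq y 0; first by rewrite y0 in cy *.
apply: (@constructible_meet_sep (0, 0) (0, y) (0, 0) (1, 0)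
  (circle (0, 0) (0, y)) (line (0, 0) (1, 0)) _ (0, y)) => //.
- by split; [apply: pair_neq; rewrite (eq_sym 0 y) y0 orbT|right].
- by split; [apply: pair_neq; rewrite eq_sym oner_eq0|left].
- by rewrite /line /= => h; move/eqP: y0; apply; lra.
- by rewrite /circle /=; ring.
- by rewrite /line /=; ring.
Qed.

Lemma constructible_swap_inv x : N x -> C (0, x).
Proof.
rewrite /N /= => cx; have [x0|x0] := eqVneq x 0; first by rewrite x0 in cx *.
apply: (@constructible_meet_sep (0, 0) (x, 0) (0, 0) (0, 1)
  (circle (0, 0) (x, 0)) (line (0, 0) (0, 1)) _ (x, 0)) => //.
- by split; [apply: pair_neq; rewrite (eq_sym 0 x) x0|right].
- by split; [apply: pair_neq; rewrite (eq_sym 0 1) oner_eq0 orbT|left].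
- by rewrite /line /= => h; move/eqP: x0; apply; lra.
- by rewrite /circle /=; ring.
- by rewrite /line /=; ring.
Qed.

Lemma constructible_coordP x y : C (x, y) <-> N x /\ N y.
Proof.
split=> [cp|[cx cy]].
  (* The midpoints of the point with its conjugate and with the opposite of its conjugate are its
     projections on the axes. *)
  have cc := constructible_conj cp; split.
    have := constructible_midpoint cp cc.
    by rewrite subrr mul0r (_ : (x + x) / 2 = x) //; field.
  apply: constructible_swap.
  have := constructible_midpoint cp (constructible_opp cc).
  by rewrite subrr mul0r opprK (_ : (y + y) / 2 = y) //; field.
have := constructible_add cx (constructible_swap_inv cy).
by rewrite addr0 add0r.
Qed.

Lemma subfield_constructible : subfield N.
Proof.
have N0 : N 0 by [].
have N1 : N 1 by [].
split=> // [x y cx cy|x y cx cy|x cx].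
- have := constructible_add cx (constructible_opp cy).
  by rewrite oppr0 addr0.
(* The line of slope [x] through the origin is cut at abscissa [y]. *)
- suff /constructible_coordP[] : C (y, x * y) by [].
  apply: (@constructible_meet_sep (0, 0) (1, x) (y, 0) (y, 1)
    (line (0, 0) (1, x)) (line (y, 0) (y, 1)) _ (y + 1, x * (y + 1))) => //.
  + exact/constructible_coordP.
  + exact/constructible_coordP.
  + by split; [apply: pair_neq; rewrite eq_sym oner_eq0|left].
  + by split; [apply: pair_neq; rewrite (eq_sym 0 1) oner_eq0 orbT|left].
  + by rewrite /line /=; ring.
  + by rewrite /line /= => h; lra.
  + by rewrite /line /=; ring.
  + by rewrite /line /=; ring.
have [->|x0] := eqVneq x 0; first by rewrite invr0.
(* The line of slope [x^-1] through the origin is cut at abscissa 1. *)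
suff /constructible_coordP[] : C (1, x^-1) by [].
apply: (@constructible_meet_sep (0, 0) (x, 1) (1, 0) (1, 1)
  (line (0, 0) (x, 1)) (line (1, 0) (1, 1)) _ (0, 0)) => //.
- exact/constructible_coordP.
- exact/constructible_coordP.
- by split; [apply: pair_neq; rewrite (eq_sym 0 1) oner_eq0 orbT|left].
- by split; [apply: pair_neq; rewrite (eq_sym 0 1) oner_eq0 orbT|left].
- by rewrite /line /=; ring.
- by rewrite /line /= => h; lra.
- by rewrite /line /=; field.
- by rewrite /line /=; ring.
Qed.

(* The circle with diameter [-1, a] meets the y-axis at the square root of a. *)
Lemma constructible_sqrt a : 0 <= a -> N a -> N (Num.sqrt a).
Proof.
move=> a0 ca; suff /constructible_coordP[] : C (0, Num.sqrt a) by [].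
have sN := subfield_constructible.
apply: (@constructible_meet_sep ((a - 1) / 2, 0) (a, 0) (0, 0) (0, 1)
  (circle ((a - 1) / 2, 0) (a, 0)) (line (0, 0) (0, 1)) _ (-1, 0)) => //.
- by apply/constructible_coordP; split; mem sN.
- by split; [apply: pair_neq; apply/orP; left; apply/eqP; lra|right].
- by split; [apply: pair_neq; rewrite (eq_sym 0 1) oner_eq0 orbT|left].
- by rewrite /circle /=; field.
- by rewrite /line /= => h; lra.
- by rewrite /circle /= subr0 sqr_sqrtr //; field.
- by rewrite /line /=; ring.
Qed.

End Constructions.

(** * Extensions of degree prime to 6 *)

Lemma countable_vect (K : fieldType) (V : vectType K) :
  countable [set: K] -> countable [set: V].
Proof.
case/countable_injP=> g g_inj.
apply/countable_injP.
exists (fun x => choice.pickle [ffun i => g (coord (vbasis {:V}) i x)]) => x y _ _ /=.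
move=> /(pcan_inj choice.pickleK)/ffunP gxy.
rewrite (coord_vbasis (memvf x)) (coord_vbasis (memvf y)).
apply: eq_bigr => i _; congr (_ *: _).
by have := gxy i; rewrite !ffunE; apply: g_inj; rewrite inE.
Qed.

(** Over the field generated by [y], [x] is a root of the monic cubic [p], so its degree is at most
    3. That degree divides [\dim {:F}], which rules out 2 and 3. *)
Lemma mem_adjoin_trisection (K : fieldType) (F : fieldExtType K) (x : F) :
  coprime (\dim {:F}) 2 -> coprime (\dim {:F}) 3 ->
  x \in <<1; x ^+ 3 - 3%:R * x>>%VS.
Proof.
move=> co2 co3; set y := x ^+ 3 - _; set E := <<1; y>>%AS.
rewrite -[_ \in _]/(x \in E) -adjoin_deg_eq1.
pose p : {poly F} := 'X^3 - (3%:R *: 'X + y%:P).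
have size_p : size p = 4.
  rewrite /p size_polyDl ?size_polyXn // size_polyN.
  rewrite (leq_ltn_trans (size_polyD _ _)) // gtn_max.
  rewrite (leq_ltn_trans (size_scale_leq _ _)) ?size_polyX //.
  by rewrite (leq_ltn_trans (size_polyC_leq1 _)).
have Ep : p \is a polyOver E.
  rewrite rpredB ?rpredX ?polyOverX // rpredD ?polyOverC ?memv_adjoin //.
  by rewrite polyOverZ ?polyOverX // rpred_nat.
have px : root p x.
  rewrite /root /p !(hornerD, hornerN, hornerXn, hornerZ, hornerX, hornerC).
  by rewrite /y addrC [_ * _ + _]addrC subrK addNr.
have := minPoly_dvdp Ep px => /dvdp_leq; rewrite -size_poly_eq0 size_p => /(_ isT).
rewrite size_minPoly ltnS.
have : (adjoin_degree E x %| \dim {:F})%N.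
  apply: dvdn_trans (field_dimS (subvf <<E; x>>%AS)).
  by rewrite /= dim_Fadjoin dvdn_mulr.
case: (adjoin_degree E x) => [|[|[|[|n]]]] //.
(* Degree 0 would force [\dim {:F}] to be 0, which is not coprime to 2. *)
- by rewrite dvd0n => /eqP d0; rewrite d0 in co2.
- by move=> d2 _; move: co2; rewrite coprime_sym prime_coprime // d2.
- by move=> d3 _; move: co3; rewrite coprime_sym prime_coprime // d3.
Qed.

Section RealFields.
Variables (R : realType) (K : fieldType) (F : fieldExtType K).
Variable iota : {rmorphism F -> R}.
Local Notation FR := (real_field iota).
Local Notation KR := (real_base_field iota).

Lemma subfield_range (L : fieldType) (g : {rmorphism L -> R}) : subfield (range g).
Proof.
split.
- by exists 1 => //; rewrite rmorph1.
- by move=> _ _ [a _ <-] [b _ <-]; exists (a - b) => //; rewrite rmorphB.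
- by move=> _ _ [a _ <-] [b _ <-]; exists (a * b) => //; rewrite rmorphM.
- by move=> _ [a _ <-]; exists a^-1 => //; rewrite fmorphV.
Qed.

Lemma subfield_real_field : subfield FR.
Proof. exact: subfield_range. Qed.

Lemma subfield_real_base_field : subfield KR.
Proof. exact: (subfield_range (iota \o GRing.in_alg F)). Qed.

Lemma real_base_field_sub : KR `<=` FR.
Proof. by move=> _ [k _ <-]; exists k%:A. Qed.

(** This turns the abstract dimension into the length of a basis inside [R], the form that
    [tower_odd] needs. *)
Lemma real_field_basis :
  is_basis KR FR (fun i : 'I_(\dim {:F}) => iota (vbasis {:F})`_i).
Proof.
have iotaZ (k : 'I_(\dim {:F}) -> K) :
    iota (\sum_i k i *: (vbasis {:F})`_i) =
    \sum_i iota (k i)%:A * iota (vbasis {:F})`_i.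
  rewrite rmorph_sum; apply: eq_bigr => i _.
  by rewrite -rmorphM mulr_algl.
split=> [x|a KRa].
  split=> [[z _ <-]|[a KRa ->]].
    exists (fun i => iota (coord (vbasis {:F}) i z)%:A) => [i|].
      by exists (coord (vbasis {:F}) i z).
    by rewrite {1}(coord_vbasis (memvf z)) iotaZ.
  have /choice [k ka] i : exists k, iota k%:A = a i by case: (KRa i) => k _; exists k.
  exists (\sum_i k i *: (vbasis {:F})`_i) => //; rewrite iotaZ.
  by apply: eq_bigr => i _; rewrite ka.
have /choice [k ka] i : exists k, iota k%:A = a i by case: (KRa i) => k _; exists k.
rewrite (eq_bigr (fun i => iota (k i)%:A * iota (vbasis {:F})`_i)); last first.
  by move=> i _; rewrite ka.
rewrite -iotaZ => /eqP; rewrite fmorph_eq0 => /eqP k0 i.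
have /freeP/(_ k k0 i) ki := basis_free (vbasisP {:F}).
by rewrite -ka ki scale0r rmorph0.
Qed.

(* As [F : K] is prime to 6, the degree of x over K (x ^ 3 - 3 x), which is at
   most 3, must be 1. *)
Lemma trisection_poly_generates (N : set R) x :
  coprime (\dim {:F}) 2 -> coprime (\dim {:F}) 3 ->
  subfield N -> KR `<=` N -> FR x -> N (trisection_poly x) -> N x.
Proof.
move=> co2 co3 sN KN [z _ <-] Nfz.
have /Fadjoin_polyP[p /polyOverP p1 zE] := mem_adjoin_trisection z co2 co3.
(* [z] is a polynomial over [K] in its cubic value; the identity is transported by [iota]. *)
have -> : iota z = (map_poly iota p).[trisection_poly (iota z)].
  rewrite {1}zE -horner_map /=; congr horner.
  by rewrite /trisection_poly rmorphB rmorphXn rmorphM rmorph_nat.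
apply: subfield_horner => // i; rewrite coef_map; apply: KN.
by have /vlineP[k ->] := p1 i; exists k.
Qed.

End RealFields.

(** * The triple-angle cubic on the real line *)

Lemma trisection_poly_cos (R : realType) (a : R) :
  trisection_poly (2 * cos a) = 2 * cos (3 * a).
Proof.
rewrite (_ : 3 * a = a + a + a); last by ring.
rewrite /trisection_poly !cosD sinD.
transitivity (2 * (cos a ^+ 3 - 3 * cos a * sin a ^+ 2)); last by ring.
by rewrite sin2cos2; ring.
Qed.

(** With [f = trisection_poly], [f x + 2 = (x - 1)^2 (x + 2)] and [f x - 2 = (x + 1)^2 (x - 2)]. *)
Lemma trisection_poly_bound (R : realType) (x : R) :
  -2 <= trisection_poly x <= 2 -> -2 <= x <= 2.
Proof.
rewrite /trisection_poly => /andP[l u]; apply/andP; split; rewrite leNgt; apply/negP => h.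
  have : 0 < (x - 1) ^+ 2 * (- 2 - x)
    by apply: mulr_gt0; [rewrite exprn_even_gt0 //=; apply/eqP => ?|]; lra.
  by rewrite (_ : _ * _ = - (x ^+ 3 - 3 * x) - 2); [lra|ring].
have : 0 < (x + 1) ^+ 2 * (x - 2)
    by apply: mulr_gt0; [rewrite exprn_even_gt0 //=; apply/eqP => ?|]; lra.
by rewrite (_ : _ * _ = (x ^+ 3 - 3 * x) - 2); [lra|ring].
Qed.

(** The difference of the values is [x - y] times [x^2 + x y + y^2 - 3], and the second factor is
    negative on the open interval from -1 to 1. *)
Lemma trisection_poly_inj (R : realType) (x y : R) :
  `|x| < 1 -> `|y| < 1 -> trisection_poly x = trisection_poly y -> x = y.
Proof.
move=> /ltr_normlP[x1 x2] /ltr_normlP[y1 y2] fxy.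
have /eqP : (x - y) * (x ^+ 2 + x * y + y ^+ 2 - 3) = 0.
  by apply/eqP; rewrite -subr_eq0; move: fxy; rewrite /trisection_poly => fxy; apply/eqP; lra.
rewrite mulf_eq0 subr_eq0 => /orP[/eqP //|/eqP h].
by exfalso; nra.
Qed.

(** * Trisection numbers in an extension of degree prime to 6 *)

Theorem proposition3p4 (R : realType) (K : fieldExtType rat)
    (F : fieldExtType K) (iota : {rmorphism F -> R}) :
  let f := @trisection_poly R in
  let FR := real_field iota in
  let KR := real_base_field iota in
  KR `<=` constructible ->
  coprime (\dim {:F}) 2 -> coprime (\dim {:F}) 3 ->
  [/\ Tri `&` FR = f @` (FR `&` [set x | -2 <= x <= 2]),
      forall y : R, (f @` (FR `\` KR)) y -> ~ constructible y
    & FR <> KR ->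
      (((f @` (FR `\` KR)) `&` (Tri `\` constructible)) #= [set: nat])%card].
Proof.
move=> f FR KR KRc co2 co3.
have sF : subfield FR := subfield_real_field iota.
have sK : subfield KR := subfield_real_base_field iota.
have TriF : Tri `&` FR = f @` (FR `&` [set x | -2 <= x <= 2]).
  rewrite eqEsubset; split=> [_ [[a tri <-] FRa]|_ [x [FRx xbd] <-]].
    have FRc : FR (cos a) by rewrite (_ : cos a = 2 * cos a / 2); [mem sF|field].
    have FRs : FR (sin a ^+ 2) by rewrite sin2cos2; mem sF.
    (* The given points have coordinates in [adj FR (sin a)]. Since [sin a ^+ 2] lies in [FR], this
       is itself a quadratic step over [FR]. *)
    have [E [t Ec _]] := constructible_tower tri (subfield_adj sF FRs)
      (fun p => ltac:(case=> [[->|->]|->] /=; split;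
         first [exact: adj_gen | by apply: sub_adj; mem sF])).
    have {t}t := tower_step FRs t.
    have [sE _] := tower_sub t sF.
    have [|x FRx fx] := tower_trisection_root t sF FRa.
      exists (2 * cos (a / 3)); first by mem sE.
      by rewrite trisection_poly_cos [3 * _]mulrC divfK.
    (* The root found in [FR] need not be [2 * cos (a / 3)], so its bound is deduced from that of
       its image. *)
    exists x => //; split => //; apply: trisection_poly_bound; rewrite fx.
    have := cos_le1 a; have := cos_geN1 a => ? ?; apply/andP; split; lra.
  have FRfx : FR (f x) by rewrite /f /trisection_poly; mem sF.
  split => //.
  have xbd' : -1 <= x / 2 <= 1 by case/andP: xbd => ? ?; apply/andP; split; lra.
  (* The angle to be trisected is [3 * b], where [x = 2 * cos b]. *)
  pose b := acos (x / 2).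
  have cb : cos b = x / 2 by rewrite acosK // in_itv.
  have fx : 2 * cos (3 * b) = f x by rewrite -trisection_poly_cos cb [2 * _]mulrC divfK.
  exists (3 * b) => //; rewrite /trisectable [_ / 3]mulrC mulKf //.
  set S := [set (0, 0); (1, 0); _].
  have S0 : S (0, 0) by left; left.
  have S1 : S (1, 0) by left; right.
  have sN := subfield_constructible S0 S1.
  have KN : KR `<=` constructible_coord S.
    move=> y /KRc; apply: constructible_from_sub => p [->|->] //.
  have /(constructible_coordP S0 S1)[Nc _] :
    constructible_from S (cos (3 * b), sin (3 * b)) by apply: constructible_base; right.
  have Nx : constructible_coord S x.
    apply: (trisection_poly_generates co2 co3 sN KN FRx).
    by rewrite -/(f x) -fx; mem sN.
  apply/(constructible_coordP S0 S1); split; first by rewrite cb; mem sN.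
  (* The sine of [b] is the nonnegative square root of [1 - (x / 2) ^+ 2]. *)
  rewrite sin_acos //; apply: constructible_sqrt => //; last by mem sN.
  by rewrite subr_ge0; case/andP: xbd' => ? ?; nra.
have notc : forall y : R, (f @` (FR `\` KR)) y -> ~ constructible y.
  move=> _ [x [FRx nKRx] <-] cfx; apply: nKRx.
  have S0 : [set (0, 0); (1, 0)] (0 : R, 0 : R) by left.
  have S1 : [set (0, 0); (1, 0)] (1 : R, 0 : R) by right.
  have sN := subfield_constructible S0 S1.
  have cx := trisection_poly_generates co2 co3 sN KRc FRx cfx.
  (* The initial points have coordinates 0 and 1, so the tower may start at [KR], over which [FR]
     has odd degree. *)
  have [E [t Ex _]] := constructible_tower cx sK
    (fun p => ltac:(case=> [->|->] /=; split; mem sK)).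
  have odd_n : odd (\dim {:F}) by rewrite -coprimen2.
  exact: (tower_odd t odd_n sK sF (@real_base_field_sub _ _ _ iota)
    (real_field_basis iota)).
split => // neFK; apply: eq_card_nat.
  (* The set lies in the image of [FR], which is countable because [F] has finite dimension over
     [K], and [K] over the rationals. *)
  apply: (@sub_countable _ _ _ FR); last first.
    apply: sub_countable (card_image_le _ _) _.
    exact: (@countable_vect _ F (@countable_vect _ K (countableP _))).
  apply: card_le_trans (card_image_le f FR); apply: subset_card_le.
  by move=> _ [[x [FRx _] <-] _]; exists x.
have [z [FRz nKRz]] : exists z, FR z /\ ~ KR z.
  apply/not_existsP => h; apply: neFK; rewrite eqEsubset; split.
    by move=> x FRx; apply: contrapT => nKRx; apply: (h x).
  exact: real_base_field_sub.
have z0 : z != 0 by apply/eqP => z0; apply: nKRz; rewrite z0; apply: subfield0.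
(* Dividing [z] by integers larger than its absolute value gives infinitely many elements of [FR]
   outside [KR], all in the interval where the cubic is injective. *)
pose m k : R := (Num.bound `|z| + k)%:R.
have mz k : `|z| < m k.
  by apply: (lt_le_trans (archi_boundP (normr_ge0 z))); rewrite /m ler_nat leq_addr.
have m0 k : m k != 0 by rewrite gt_eqF // (le_lt_trans _ (mz k)).
pose g k := z / m k.
have g1 k : `|g k| < 1.
  by rewrite normrM normfV [`|m k|]ger0_norm ?ler0n // ltr_pdivrMr ?mul1r // (le_lt_trans _ (mz k)).
have FRg k : (FR `\` KR) (g k).
  split; first by rewrite /g /m; mem sF.
  move=> KRg; apply: nKRz; have -> : z = g k * m k by rewrite /g divfK.
  by apply: (subfieldM sK) KRg (subfield_nat sK _).
have fg_inj : injective (f \o g).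
  move=> j k /(trisection_poly_inj (g1 j) (g1 k)) /(mulfI z0)/invr_inj/eqP.
  by rewrite /m eqr_nat eqn_add2l => /eqP.
apply/infiniteP.
have /card_esym := @inj_card_eq _ _ [set: nat] (f \o g) (in2W fg_inj).
rewrite card_eq_le => /andP[le _]; apply: (card_le_trans le).
apply: subset_card_le => _ [k _ <-]; split; first by exists (g k).
split; last by apply: notc; exists (g k).
suff : (Tri `&` FR) ((f \o g) k) by case.
rewrite TriF; exists (g k) => //; split; first by case: (FRg k).
by have /ltr_normlP[? ?] := g1 k; apply/andP; split; lra.
Qed.
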